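(* There is a 1-1 correspondence between strict $2$-term Nijenhuis $L_\infty$-algebras and crossed modules of Nijenhuis Lie algebras.
   Context: All vector spaces are over a fixed field. 2-term Nijenhuis $L_\infty$-algebras. A $2$-term $L_\infty$-algebra $(\mathcal{L}_1\xrightarrow{\partial}\mathcal{L}_0,l_2,l_3)$ is a $2$-term chain complex $\mathcal{L}_1\xrightarrow{\partial}\mathcal{L}_0$ with an antisymmetric bilinear map $l_2:\mathcal{L}_i\times\mathcal{L}_j\to\mathcal{L}_{i+j}$ ($0\le i,j,i+j\le1$; so $l_2(h,x)=-l_2(x,h)$) and an antisymmetric trilinear map $l_3:\mathcal{L}_0\times\mathcal{L}_0\times\mathcal{L}_0\to\mathcal{L}_1$ such that for all $x,y,z,w\in\mathcal{L}_0$ and $h,k\in\mathcal{L}_1$: $\partial l_2(x,h)=l_2(x,\partial h)$; $l_2(\partial h,k)=l_2(h,\partial k)$; $\partial l_3(x,y,z)=l_2(x,l_2(y,z))+l_2(y,l_2(z,x))+l_2(z,l_2(x,y))$; $l_3(x,y,\partial h)=l_2(x,l_2(y,h))+l_2(y,l_2(h,x))+l_2(h,l_2(x,y))$; and $l_2(x,l_3(y,z,w))-l_2(y,l_3(x,z,w))+l_2(z,l_3(x,y,w))-l_2(w,l_3(x,y,z))-l_3(l_2(x,y),z,w)+l_3(l_2(x,z),y,w)-l_3(l_2(x,w),y,z)-l_3(l_2(y,z),x,w)+l_3(l_2(y,w),x,z)-l_3(l_2(z,w),x,y)=0$. A homotopy Nijenhuis operator on it is a triple $(\mathcal{N}_0,\mathcal{N}_1,\mathcal{N}_2)$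 of linear maps $\mathcal{N}_0:\mathcal{L}_0\to\mathcal{L}_0$, $\mathcal{N}_1:\mathcal{L}_1\to\mathcal{L}_1$ and an antisymmetric bilinear map $\mathcal{N}_2:\mathcal{L}_0\times\mathcal{L}_0\to\mathcal{L}_1$ such that, for all $x,y,z\in\mathcal{L}_0$ and $h\in\mathcal{L}_1$, writing $l_2^{\mathcal{N}}(x,y)=l_2(\mathcal{N}_0x,y)+l_2(x,\mathcal{N}_0y)-\mathcal{N}_0l_2(x,y)$: (1) $\partial\mathcal{N}_1=\mathcal{N}_0\partial$; (2) $\mathcal{N}_0(l_2^{\mathcal{N}}(x,y))-l_2(\mathcal{N}_0x,\mathcal{N}_0y)=\partial\mathcal{N}_2(x,y)$; (3) $\mathcal{N}_1\big(l_2(\mathcal{N}_0x,h)+l_2(x,\mathcal{N}_1h)-\mathcal{N}_1l_2(x,h)\big)-l_2(\mathcal{N}_0x,\mathcal{N}_1h)=\mathcal{N}_2(x,\partial h)$; (4) $l_2(\mathcal{N}_0x,\mathcal{N}_2(y,z))+l_2(\mathcal{N}_0y,\mathcal{N}_2(z,x))+l_2(\mathcal{N}_0z,\mathcal{N}_2(x,y))-\mathcal{N}_2(l_2^{\mathcal{N}}(x,y),z)-\mathcal{N}_2(l_2^{\mathcal{N}}(y,z),x)-\mathcal{N}_2(l_2^{\mathcal{N}}(z,x),y)-\mathcal{N}_1\big(l_2(x,\mathcal{N}_2(y,z))+l_2(y,\mathcal{N}_2(z,x))+l_2(z,\mathcal{N}_2(x,y))-\mathcal{N}_2(l_2(x,y),z)-\mathcal{N}_2(l_2(y,z),x)-\mathcal{N}_2(l_2(z,x),y)\big)$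 $=l_3(\mathcal{N}_0x,\mathcal{N}_0y,\mathcal{N}_0z)-\mathcal{N}_1\big(l_3(\mathcal{N}_0x,\mathcal{N}_0y,z)+l_3(\mathcal{N}_0x,y,\mathcal{N}_0z)+l_3(x,\mathcal{N}_0y,\mathcal{N}_0z)\big)+\mathcal{N}_1^2\big(l_3(\mathcal{N}_0x,y,z)+l_3(x,\mathcal{N}_0y,z)+l_3(x,y,\mathcal{N}_0z)\big)-\mathcal{N}_1^3l_3(x,y,z)$. A $2$-term Nijenhuis $L_\infty$-algebra is a $2$-term $L_\infty$-algebra together with a homotopy Nijenhuis operator on it; it is strict if $l_3=0$ and $\mathcal{N}_2=0$. Crossed modules. A Nijenhuis Lie algebra $(\mathfrak{g},[\cdot,\cdot]_\mathfrak{g},N)$ is a Lie algebra with a linear map $N:\mathfrak{g}\to\mathfrak{g}$ satisfying $[Nx,Ny]_\mathfrak{g}=N([Nx,y]_\mathfrak{g}+[x,Ny]_\mathfrak{g}-N[x,y]_\mathfrak{g})$ for all $x,y\in\mathfrak{g}$; homomorphisms of Nijenhuis Lie algebras are Lie algebra homomorphisms commuting with the Nijenhuis operators. A Nijenhuis representation of it is a triple $(\mathcal{V},\rho,S)$ with $(\mathcal{V},\rho)$ a representation of the Lie algebra $(\mathfrak{g},[\cdot,\cdot]_\mathfrak{g})$ and $S:\mathcal{V}\to\mathcal{V}$ linear with $\rho_{Nx}S(v)=S(\rho_{Nx}v+\rho_xS(v)-S(\rho_xv))$ for all $x\in\mathfrak{g}$, $v\in\mathcal{V}$. A crossed module of Nijenhuis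 Lie algebras is a quadruple $\big((\mathfrak{g},[\cdot,\cdot]_\mathfrak{g},N),(\mathfrak{h},[\cdot,\cdot]_\mathfrak{h},S),t,\rho\big)$ consisting of two Nijenhuis Lie algebras, a homomorphism $t:\mathfrak{h}\to\mathfrak{g}$ of Nijenhuis Lie algebras and a Lie algebra homomorphism $\rho:\mathfrak{g}\to\mathrm{Der}(\mathfrak{h})$ (the Lie algebra of derivations of $\mathfrak{h}$) such that $(\mathfrak{h},\rho,S)$ is a Nijenhuis representation of $(\mathfrak{g},[\cdot,\cdot]_\mathfrak{g},N)$ and, for all $x\in\mathfrak{g}$ and $h,k\in\mathfrak{h}$, $t(\rho_xh)=[x,t(h)]_\mathfrak{g}$ and $\rho_{t(h)}k=[h,k]_\mathfrak{h}$. *)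

(* Defs.v *)
From HB Require Import structures.
From mathcomp Require Import all_boot all_order all_algebra.

Set Implicit Arguments.
Unset Strict Implicit.
Unset Printing Implicit Defensive.

Import GRing.Theory.
Local Open Scope ring_scope.

Definition trilinear (K : fieldType) (U V : lmodType K) (f : U -> U -> U -> V)
    : Prop :=
  [/\ forall y z, linear (fun x => f x y z),
      forall x z, linear (fun y => f x y z) &
      forall x y, linear (fun z => f x y z)].

(* Over an arbitrary field, antisymmetry is the sign rule below; in
   characteristic 2 it does not imply that f x x vanishes. *)
Definition antisymmetric2 (K : fieldType) (U V : lmodType K) (f : U -> U -> V)
    : Prop :=
  forall x y, f y x = - f x y.

(* The transpositions (1 2) and (2 3) generate all permutations of the three
   arguments. *)
Definition antisymmetric3 (K : fieldType) (U V : lmodType K)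
    (f : U -> U -> U -> V) : Prop :=
  (forall x y z, f y x z = - f x y z) /\ (forall x y z, f x z y = - f x y z).

(* A 2-term L_oo-algebra structure on the spaces V0 (degree 0) and V1
   (degree 1).  The operation l2 : L_i x L_j -> L_(i+j) has one component for
   each (i, j) in {(0,0), (0,1), (1,0)}. *)
Record linf2 (K : fieldType) (V0 V1 : lmodType K) := Linf2 {
  partial : {linear V1 -> V0};
  l2_00 : {bilinear V0 -> V0 -> V0};
  l2_01 : {bilinear V0 -> V1 -> V1};
  l2_10 : {bilinear V1 -> V0 -> V1};
  l3 : V0 -> V0 -> V0 -> V1;
  l2_00_antisym : antisymmetric2 l2_00;
  l2_10_antisym : forall x h, l2_10 h x = - l2_01 x h;
  l3_trilinear : trilinear l3;
  l3_antisym : antisymmetric3 l3;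
  partial_l2 : forall x h, partial (l2_01 x h) = l2_00 x (partial h);
  l2_partial : forall h k, l2_01 (partial h) k = l2_10 h (partial k);
  partial_l3 : forall x y z,
    partial (l3 x y z)
    = l2_00 x (l2_00 y z) + l2_00 y (l2_00 z x) + l2_00 z (l2_00 x y);
  l3_partial : forall x y h,
    l3 x y (partial h)
    = l2_01 x (l2_01 y h) + l2_01 y (l2_10 h x) + l2_10 h (l2_00 x y);
  l2_l3 : forall x y z w,
    l2_01 x (l3 y z w) - l2_01 y (l3 x z w)
    + l2_01 z (l3 x y w) - l2_01 w (l3 x y z)
    - l3 (l2_00 x y) z w + l3 (l2_00 x z) y w - l3 (l2_00 x w) y z
    - l3 (l2_00 y z) x w + l3 (l2_00 y w) x z - l3 (l2_00 z w) x y = 0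
}.

Definition l2_deformed (K : fieldType) (V0 V1 : lmodType K) (L : linf2 V0 V1)
    (N0 : V0 -> V0) (x y : V0) : V0 :=
  l2_00 L (N0 x) y + l2_00 L x (N0 y) - N0 (l2_00 L x y).

Record homotopy_nijenhuis (K : fieldType) (V0 V1 : lmodType K)
    (L : linf2 V0 V1) := HomotopyNijenhuis {
  nij0 : {linear V0 -> V0};
  nij1 : {linear V1 -> V1};
  nij2 : {bilinear V0 -> V0 -> V1};
  nij2_antisym : antisymmetric2 nij2;
  nij_partial : forall h, partial L (nij1 h) = nij0 (partial L h);
  nij_l2_00 : forall x y,
    nij0 (l2_deformed L nij0 x y) - l2_00 L (nij0 x) (nij0 y)
    = partial L (nij2 x y);
  nij_l2_01 : forall x h,
    nij1 (l2_01 L (nij0 x) h + l2_01 L x (nij1 h) - nij1 (l2_01 L x h))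
      - l2_01 L (nij0 x) (nij1 h)
    = nij2 x (partial L h);
  nij_l3 : forall x y z,
    l2_01 L (nij0 x) (nij2 y z) + l2_01 L (nij0 y) (nij2 z x)
    + l2_01 L (nij0 z) (nij2 x y)
    - nij2 (l2_deformed L nij0 x y) z
    - nij2 (l2_deformed L nij0 y z) x
    - nij2 (l2_deformed L nij0 z x) y
    - nij1 (l2_01 L x (nij2 y z) + l2_01 L y (nij2 z x) + l2_01 L z (nij2 x y)
            - nij2 (l2_00 L x y) z - nij2 (l2_00 L y z) x
            - nij2 (l2_00 L z x) y)
    = l3 L (nij0 x) (nij0 y) (nij0 z)
      - nij1 (l3 L (nij0 x) (nij0 y) z + l3 L (nij0 x) y (nij0 z)
              + l3 L x (nij0 y) (nij0 z))
      + nij1 (nij1 (l3 L (nij0 x) y z + l3 L x (nij0 y) z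
                    + l3 L x y (nij0 z)))
      - nij1 (nij1 (nij1 (l3 L x y z)))
}.

Record nij_linf2 (K : fieldType) (V0 V1 : lmodType K) := NijLinf2 {
  nij_linf2_alg :> linf2 V0 V1;
  nij_linf2_op : homotopy_nijenhuis nij_linf2_alg
}.

Definition strict (K : fieldType) (V0 V1 : lmodType K)
    (L : nij_linf2 V0 V1) : Prop :=
  (forall x y z, l3 L x y z = 0) /\ (forall x y, nij2 (nij_linf2_op L) x y = 0).

Record strict_nij_linf2 (K : fieldType) (V0 V1 : lmodType K) :=
  StrictNijLinf2 {
    strict_alg :> nij_linf2 V0 V1;
    strict_algP : strict strict_alg
  }.

(* The bracket is antisymmetric in the same sense as l2. *)
Record lie_algebra (K : fieldType) (g : lmodType K) := LieAlgebra {
  lie : {bilinear g -> g -> g};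
  lie_antisym : antisymmetric2 lie;
  lie_jacobi : forall x y z,
    lie x (lie y z) + lie y (lie z x) + lie z (lie x y) = 0
}.

Record nijenhuis_lie (K : fieldType) (g : lmodType K) := NijenhuisLie {
  nij_lie_alg :> lie_algebra g;
  nij_op : {linear g -> g};
  nij_opP : forall x y,
    lie nij_lie_alg (nij_op x) (nij_op y)
    = nij_op (lie nij_lie_alg (nij_op x) y + lie nij_lie_alg x (nij_op y)
              - nij_op (lie nij_lie_alg x y))
}.

Definition nijenhuis_lie_hom (K : fieldType) (h g : lmodType K)
    (H : nijenhuis_lie h) (G : nijenhuis_lie g) (t : {linear h -> g}) : Prop :=
  (forall a b, t (lie H a b) = lie G (t a) (t b)) /\
  (forall a, t (nij_op H a) = nij_op G (t a)).

Definition lie_representation (K : fieldType) (g V : lmodType K)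
    (G : lie_algebra g) (rho : {bilinear g -> V -> V}) : Prop :=
  forall x y v, rho (lie G x y) v = rho x (rho y v) - rho y (rho x v).

Definition nijenhuis_representation (K : fieldType) (g V : lmodType K)
    (G : nijenhuis_lie g) (rho : {bilinear g -> V -> V})
    (S : {linear V -> V}) : Prop :=
  lie_representation G rho /\
  (forall x v,
    rho (nij_op G x) (S v) = S (rho (nij_op G x) v + rho x (S v) - S (rho x v))).

Definition derivation (K : fieldType) (h : lmodType K) (H : lie_algebra h)
    (D : h -> h) : Prop :=
  linear D /\ (forall a b, D (lie H a b) = lie H (D a) b + lie H a (D b)).

(* A Lie algebra homomorphism g -> Der(h), in uncurried form: x |-> rho x is
   linear, takes its values in derivations, and sends the bracket of g to the
   commutator of derivations. *)
Definition lie_hom_to_Der (K : fieldType) (g h : lmodType K)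
    (G : lie_algebra g) (H : lie_algebra h) (rho : {bilinear g -> h -> h})
    : Prop :=
  (forall x, derivation H (rho x)) /\
  (forall x y a, rho (lie G x y) a = rho x (rho y a) - rho y (rho x a)).

Record crossed_module (K : fieldType) (g h : lmodType K) := CrossedModule {
  cm_g : nijenhuis_lie g;
  cm_h : nijenhuis_lie h;
  cm_t : {linear h -> g};
  cm_rho : {bilinear g -> h -> h};
  cm_t_hom : nijenhuis_lie_hom cm_h cm_g cm_t;
  cm_rho_hom : lie_hom_to_Der cm_g cm_h cm_rho;
  cm_rho_nij : nijenhuis_representation cm_g cm_rho (nij_op cm_h);
  cm_equivariant : forall x a, cm_t (cm_rho x a) = lie cm_g x (cm_t a);
  cm_peiffer : forall a b, cm_rho (cm_t a) b = lie cm_h a b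
}.

(* The same objects bundled with their underlying vector spaces. *)
Record strictNijLinf2 (K : fieldType) := PackStrictNijLinf2 {
  linf_space0 : lmodType K;
  linf_space1 : lmodType K;
  linf_str :> strict_nij_linf2 linf_space0 linf_space1
}.

Record crossedModule (K : fieldType) := PackCrossedModule {
  cm_space_g : lmodType K;
  cm_space_h : lmodType K;
  cm_str :> crossed_module cm_space_g cm_space_h
}.

(* Main.v *)
Require Import Defs.
From HB Require Import structures.
From Stdlib Require Import ProofIrrelevance FunctionalExtensionality.
From mathcomp Require Import all_boot all_order all_algebra.

Set Implicit Arguments.
Unset Strict Implicit.
Unset Printing Implicit Defensive.

Import GRing.Theory.
Local Open Scope ring_scope.

(** With [l3 = 0] and [N2 = 0], the axioms of a 2-term Nijenhuis L_oo-algebra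
    say that [l2_00] is a Lie bracket on [V0] with Nijenhuis operator [N0]
    ([partial_l3], [nij_l2_00]), that [l2_01] is a representation of it on [V1]
    ([l3_partial]) for which [N1] is a Nijenhuis operator ([nij_l2_01]), and
    that [partial] is equivariant and intertwines the operators.  The bracket
    on [V1] is then the derived bracket [h, k] = l2_01 (partial h) k.  It is
    antisymmetric because of [l2_partial].  Its other properties follow from
    the equivariance partial (l2_01 x h) = l2_00 x (partial h), which is itself
    the compatibility of [partial] with the brackets: the Jacobi identity on
    [V1] is the representation identity at elements of the form [partial h];
    the Nijenhuis identity on [V1] is that of the action at such elements, since
    [partial] intertwines the operators; and the derivation rule for [l2_01 x]
    is the representation identity at [x] and [partial h].  Conversely, a
    crossed module yields a strict algebra when its bracket on [h] is forgotten;
    the antisymmetry of that bracket, together with the Peiffer identity, gives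
    back [l2_partial].

    Both structures are determined by the same five maps: the differential,
    the bracket in degree 0, the action and the two operators.  On the L_oo
    side [l2_10] is minus the action while [l3] and [N2] vanish; on the other
    side the bracket on [h] is forced by the Peiffer identity.  Since the two
    constructions leave these five maps unchanged, they are mutually inverse
    by the extensionality lemmas [strict_nij_linf2_ext] and
    [crossed_module_ext].  *)

(** * Extensionality of linear and bilinear maps *)

Lemma linear_ext (K : fieldType) (U V : lmodType K) (f g : {linear U -> V}) :
  f =1 g -> f = g.
Proof.
case: f g => [f [[fD] [fZ]]] [g [[gD] [gZ]]] /= /functional_extensionality efg.
by subst g; rewrite (proof_irrelevance _ fD gD) (proof_irrelevance _ fZ gZ).
Qed.

Lemma bilinear_ext (K : fieldType) (U V W : lmodType K)
    (f g : {bilinear U -> V -> W}) : f =2 g -> f = g.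
Proof.
case: f g => [f [[f1 f2 f3 f4]]] [g [[g1 g2 g3 g4]]] /= efg.
have {}efg : f = g.
  by do 2![apply: functional_extensionality => ?]; apply: efg.
subst g; rewrite (proof_irrelevance _ f1 g1) (proof_irrelevance _ f2 g2).
by rewrite (proof_irrelevance _ f3 g3) (proof_irrelevance _ f4 g4).
Qed.

(** * Auxiliary bilinear maps *)

Section BilinearMaps.
Variables (K : fieldType) (U V W : lmodType K).

Definition pack_bilinear (f : U -> V -> W) (fP : bilinear_for *:%R *:%R f) :
    {bilinear U -> V -> W} :=
  HB.pack f (bilinear_isBilinear.Build K U V W *:%R *:%R f fP).

Lemma zero_bilinearP :
  bilinear_for *:%R *:%R (fun (_ : U) (_ : V) => 0 : W).
Proof. by split=> z a x y /=; rewrite scaler0 addr0. Qed.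

Definition zero_bilinear := pack_bilinear zero_bilinearP.

Variable r : {bilinear U -> V -> W}.

Lemma opposite_bilinearP : bilinear_for *:%R *:%R (fun v u => - r u v).
Proof.
by split=> z a x y /=; rewrite ?linearPr ?linearPl opprD scalerN.
Qed.

End BilinearMaps.

Definition opposite_bilinear (K : fieldType) (U V W : lmodType K)
    (r : {bilinear U -> V -> W}) : {bilinear V -> U -> W} :=
  pack_bilinear (opposite_bilinearP r).

Section DerivedBracket.
Variables (K : fieldType) (V0 V1 : lmodType K).
Variables (t : {linear V1 -> V0}) (r : {bilinear V0 -> V1 -> V1}).

Lemma derived_bracketP : bilinear_for *:%R *:%R (fun h k => r (t h) k).
Proof. by split=> z a x y /=; rewrite ?linearP ?linearPl ?linearPr. Qed.

Definition derived_bracket : {bilinear V1 -> V1 -> V1} :=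
  pack_bilinear derived_bracketP.

End DerivedBracket.

(** * From strict algebras to crossed modules *)

Section StrictToCrossed.
Variables (K : fieldType) (V0 V1 : lmodType K) (L : strict_nij_linf2 V0 V1).

Notation d := (partial L).
Notation br := (l2_00 L).
Notation act := (l2_01 L).
Notation N0 := (nij0 (nij_linf2_op L)).
Notation N1 := (nij1 (nij_linf2_op L)).

Lemma strict_jacobi x y z :
  br x (br y z) + br y (br z x) + br z (br x y) = 0.
Proof. by rewrite -partial_l3 (strict_algP L).1 linear0. Qed.

Lemma strict_lie_representation x y h :
  act (br x y) h = act x (act y h) - act y (act x h).
Proof.
(* [l3_partial] with [l3 = 0], once [l2_10] is written as minus the action *)
have := l3_partial L x y h; rewrite (strict_algP L).1 !l2_10_antisym.
by rewrite linearNr => /esym/subr0_eq.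
Qed.

Lemma strict_nijenhuis x y :
  br (N0 x) (N0 y) = N0 (br (N0 x) y + br x (N0 y) - N0 (br x y)).
Proof.
have := nij_l2_00 (nij_linf2_op L) x y.
by rewrite (strict_algP L).2 linear0 => /subr0_eq.
Qed.

Lemma strict_nijenhuis_action x h :
  act (N0 x) (N1 h) = N1 (act (N0 x) h + act x (N1 h) - N1 (act x h)).
Proof.
have := nij_l2_01 (nij_linf2_op L) x h.
by rewrite (strict_algP L).2 => /subr0_eq.
Qed.

Notation dbr := (derived_bracket d act).

Lemma derived_bracket_antisym : antisymmetric2 dbr.
Proof. by move=> h k /=; rewrite -l2_10_antisym -l2_partial. Qed.

(** By equivariance of [d], the representation identity for the pair [d h],
    [d k] applied to [m] is the Jacobi identity in Leibniz form. *)
Lemma derived_bracket_jacobi h k m :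
  dbr h (dbr k m) + dbr k (dbr m h) + dbr m (dbr h k) = 0.
Proof.
rewrite (derived_bracket_antisym (dbr h k) m) (derived_bracket_antisym h m) /=.
by rewrite partial_l2 strict_lie_representation linearNr subrr.
Qed.

Definition strict_lie0 : lie_algebra V0 :=
  LieAlgebra (l2_00_antisym L) strict_jacobi.

Definition strict_nijenhuis0 : nijenhuis_lie V0 :=
  @NijenhuisLie K V0 strict_lie0 N0 strict_nijenhuis.

Definition strict_lie1 : lie_algebra V1 :=
  LieAlgebra derived_bracket_antisym derived_bracket_jacobi.

Lemma derived_bracket_nijenhuis h k :
  dbr (N1 h) (N1 k) = N1 (dbr (N1 h) k + dbr h (N1 k) - N1 (dbr h k)).
Proof. by rewrite /= nij_partial strict_nijenhuis_action. Qed.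

Definition strict_nijenhuis1 : nijenhuis_lie V1 :=
  @NijenhuisLie K V1 strict_lie1 N1 derived_bracket_nijenhuis.

Lemma strict_partial_hom :
  nijenhuis_lie_hom strict_nijenhuis1 strict_nijenhuis0 d.
Proof. by split=> [a b | a] /=; [rewrite partial_l2 | rewrite nij_partial]. Qed.

Lemma strict_action_hom_to_Der :
  lie_hom_to_Der strict_nijenhuis0 strict_nijenhuis1 act.
Proof.
split=> [x | x y a]; last exact: strict_lie_representation.
split=> [c a b | a b /=]; first by rewrite linearPr.
by rewrite partial_l2 strict_lie_representation subrK.
Qed.

Lemma strict_action_nijenhuis :
  nijenhuis_representation strict_nijenhuis0 act (nij_op strict_nijenhuis1).
Proof.
by split=> [x y v | x v];
  [exact: strict_lie_representation | exact: strict_nijenhuis_action].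
Qed.

Definition crossed_of_strict : crossed_module V0 V1 :=
  @CrossedModule K V0 V1 strict_nijenhuis0 strict_nijenhuis1 d act
    strict_partial_hom strict_action_hom_to_Der strict_action_nijenhuis
    (partial_l2 L) (fun a b => erefl).

End StrictToCrossed.

(** * From crossed modules to strict algebras *)

Section CrossedToStrict.
Variables (K : fieldType) (g h : lmodType K) (C : crossed_module g h).

Notation br := (lie (cm_g C)).
Notation act := (cm_rho C).
Notation zero3 := (fun _ _ _ : g => 0 : h).

Lemma zero3_trilinear : trilinear zero3.
Proof. by split=> u v a x y /=; rewrite scaler0 addr0. Qed.

Lemma zero3_antisym : antisymmetric3 zero3.
Proof. by split=> *; rewrite oppr0. Qed.

(** This is [l2_partial] for the algebra being built: the Peiffer identity
    turns both sides into brackets of [h]. *)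
Lemma crossed_action_swap a b :
  act (cm_t C a) b = opposite_bilinear act a (cm_t C b).
Proof. by rewrite /= !cm_peiffer; apply: lie_antisym. Qed.

Lemma crossed_partial_l3 x y z :
  cm_t C 0 = br x (br y z) + br y (br z x) + br z (br x y).
Proof. by rewrite linear0 lie_jacobi. Qed.

Lemma crossed_l3_partial x y a :
  0 = act x (act y a) + act y (opposite_bilinear act a x)
      + opposite_bilinear act a (br x y).
Proof. by rewrite /= (cm_rho_hom C).2 linearNr subrr. Qed.

Lemma crossed_l2_l3 x y z w :
  act x (zero3 y z w) - act y (zero3 x z w) + act z (zero3 x y w)
  - act w (zero3 x y z) - zero3 (br x y) z w + zero3 (br x z) y w
  - zero3 (br x w) y z - zero3 (br y z) x w + zero3 (br y w) x z
  - zero3 (br z w) x y = 0.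
Proof. by rewrite !linear0r !subr0 !addr0. Qed.

Definition linf2_of_crossed : linf2 g h :=
  @Linf2 K g h (cm_t C) br act (opposite_bilinear act) zero3
    (lie_antisym (cm_g C)) (fun x a => erefl) zero3_trilinear zero3_antisym
    (cm_equivariant C) crossed_action_swap crossed_partial_l3
    crossed_l3_partial crossed_l2_l3.

Definition homotopy_nijenhuis_of_crossed : homotopy_nijenhuis linf2_of_crossed.
Proof.
apply: (@HomotopyNijenhuis K g h linf2_of_crossed
          (nij_op (cm_g C)) (nij_op (cm_h C)) (zero_bilinear g g h)).
- by move=> x y; rewrite /= oppr0.
- by move=> a; rewrite /= (cm_t_hom C).2.
- by move=> x y; rewrite /= /l2_deformed /= linear0 nij_opP subrr.
- by move=> x a; rewrite /= (cm_rho_nij C).2 subrr.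
- by move=> x y z; rewrite /= !linear0r !(subr0, addr0) !linear0 !(subr0, addr0).
Defined.

Definition strict_of_crossed : strict_nij_linf2 g h :=
  @StrictNijLinf2 K g h (NijLinf2 homotopy_nijenhuis_of_crossed)
    (conj (fun x y z => erefl) (fun x y => erefl)).

End CrossedToStrict.

(** * The five maps that determine either structure *)

(** [l2_10] is absent from the hypotheses because it is minus [l2_01]; the
    remaining fields are proofs. *)
Lemma linf2_ext (K : fieldType) (V0 V1 : lmodType K) (L M : linf2 V0 V1) :
  partial L =1 partial M -> l2_00 L =2 l2_00 M -> l2_01 L =2 l2_01 M ->
  (forall x y z, l3 L x y z = l3 M x y z) -> L = M.
Proof.
move=> ed e00 e01 e3.
have e10 : l2_10 L =2 l2_10 M by move=> a x; rewrite !l2_10_antisym e01.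
have {}e3 : l3 L = l3 M.
  by do 3![apply: functional_extensionality => ?]; apply: e3.
case: L M ed e00 e01 e10 e3
  => d b00 b01 b10 c p1 p2 p3 p4 p5 p6 p7 p8 p9
     [d' b00' b01' b10' c' q1 q2 q3 q4 q5 q6 q7 q8 q9] /=.
move=> /linear_ext ed /bilinear_ext e00 /bilinear_ext e01 /bilinear_ext e10 e3.
by subst d' b00' b01' b10' c'; f_equal; apply: proof_irrelevance.
Qed.

Lemma homotopy_nijenhuis_ext (K : fieldType) (V0 V1 : lmodType K)
    (L : linf2 V0 V1) (N M : homotopy_nijenhuis L) :
  nij0 N =1 nij0 M -> nij1 N =1 nij1 M -> nij2 N =2 nij2 M -> N = M.
Proof.
case: N M => n0 n1 n2 p1 p2 p3 p4 p5 [m0 m1 m2 q1 q2 q3 q4 q5] /=.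
move=> /linear_ext e0 /linear_ext e1 /bilinear_ext e2.
by subst m0 m1 m2; f_equal; apply: proof_irrelevance.
Qed.

(** The equality of the underlying algebras has to be eliminated first, since
    the type of the operators depends on it. *)
Lemma strict_nij_linf2_ext (K : fieldType) (V0 V1 : lmodType K)
    (L M : strict_nij_linf2 V0 V1) :
  partial L =1 partial M -> l2_00 L =2 l2_00 M -> l2_01 L =2 l2_01 M ->
  nij0 (nij_linf2_op L) =1 nij0 (nij_linf2_op M) ->
  nij1 (nij_linf2_op L) =1 nij1 (nij_linf2_op M) -> L = M.
Proof.
case: L M => [[L N] sL] [[M P] sM] /= ed e00 e01.
have eLM : L = M.
  by apply: linf2_ext => // x y z; rewrite sL.1 sM.1.
subst M => eN0 eN1.
have eNP : N = P.
  by apply: homotopy_nijenhuis_ext => // x y; rewrite sL.2 sM.2.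
by subst P; rewrite (proof_irrelevance _ sL sM).
Qed.

Lemma nijenhuis_lie_ext (K : fieldType) (g : lmodType K)
    (G H : nijenhuis_lie g) :
  lie G =2 lie H -> nij_op G =1 nij_op H -> G = H.
Proof.
case: G H => [[b p1 p2] n p3] [[c q1 q2] m q3] /=.
move=> /bilinear_ext eb /linear_ext en; subst c m.
move: p3 q3; rewrite (proof_irrelevance _ q1 p1) (proof_irrelevance _ q2 p2).
by move=> p3 q3; rewrite (proof_irrelevance _ q3 p3).
Qed.

(** The bracket of [h] is absent from the hypotheses: the Peiffer identity
    expresses it through the action and [cm_t]. *)
Lemma crossed_module_ext (K : fieldType) (g h : lmodType K)
    (C D : crossed_module g h) :
  cm_t C =1 cm_t D -> lie (cm_g C) =2 lie (cm_g D) -> cm_rho C =2 cm_rho D ->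
  nij_op (cm_g C) =1 nij_op (cm_g D) -> nij_op (cm_h C) =1 nij_op (cm_h D) ->
  C = D.
Proof.
move=> et eg er eN eS.
have eh : lie (cm_h C) =2 lie (cm_h D).
  by move=> a b; rewrite -!cm_peiffer et er.
case: C D et eg er eN eS eh
  => G H t r p1 p2 p3 p4 p5 [G' H' t' r' q1 q2 q3 q4 q5] /=.
move=> /linear_ext et eg /bilinear_ext er eN eS eh.
have eG := nijenhuis_lie_ext eg eN; have eH := nijenhuis_lie_ext eh eS.
by subst t' r' G' H'; f_equal; apply: proof_irrelevance.
Qed.

(** * The correspondence *)

Theorem theorem5p6 (K : fieldType) :
  exists Phi : forall V0 V1 : lmodType K,
      strict_nij_linf2 V0 V1 -> crossed_module V0 V1,
    (forall (V0 V1 : lmodType K) (L : strict_nij_linf2 V0 V1),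
       let C := Phi V0 V1 L in
       (forall x y, lie (cm_g C) x y = l2_00 L x y) /\
       (forall x, nij_op (cm_g C) x = nij0 (nij_linf2_op L) x) /\
       (forall h k, lie (cm_h C) h k = l2_01 L (partial L h) k) /\
       (forall h, nij_op (cm_h C) h = nij1 (nij_linf2_op L) h) /\
       (forall h, cm_t C h = partial L h) /\
       (forall x h, cm_rho C x h = l2_01 L x h)) /\
    bijective (fun L : strictNijLinf2 K =>
       PackCrossedModule (Phi (linf_space0 L) (linf_space1 L) (linf_str L))).
Proof.
exists (@crossed_of_strict K); split=> [V0 V1 L C | ]; first by [].
exists (fun C : crossedModule K => PackStrictNijLinf2 (strict_of_crossed C)).
- by case=> V0 V1 L; congr PackStrictNijLinf2; apply: strict_nij_linf2_ext.
- by case=> g h C; congr PackCrossedModule; apply: crossed_module_ext.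
Qed.
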